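(* Let $b \in \mathbb{R}$, $\kappa \in \{1,-1\}$ and $\lambda > 0$. Fix one of the following three definitions of the operator $A$: (i) $A w = w - w_{xx}$; (ii) $A w = -w_{xx}$; (iii) $A w = \mu(w) - w_{xx}$, where in case (iii) all functions are assumed to be periodic in $x$ with period $1$. Let $T \in (0,\infty]$ and set $S = \frac{1-e^{-\lambda T}}{\lambda}$ (with $S = 1/\lambda$ if $T = \infty$). Let $(u,\rho)$ be real-valued functions on $[0,S)\times\mathbb{R}$ and $(v,\sigma)$ real-valued functions on $[0,T)\times\mathbb{R}$, sufficiently smooth for all derivatives in the equations below to exist in the classical sense, and suppose that they are related by $$v(t,x) = e^{-\lambda t}\, u\!\left(\frac{1-e^{-\lambda t}}{\lambda}, x\right), \qquad \sigma(t,x) = e^{-\lambda t}\, \rho\!\left(\frac{1-e^{-\lambda t}}{\lambda}, x\right), \qquad t \in [0,T),\; x \in \mathbb{R}.$$ Then $(v,\sigma)$ satisfies the weakly dissipative system $$m_t + v m_x + b\, v_x m + \lambda m + \kappa\, \sigma\sigma_x = 0, \qquad \sigma_t + (v\sigma)_x + \lambda\sigma = 0, \qquad m = A v,$$ for $x \in \mathbb{R}$, $0 < t < T$, if and only if $(u,\rho)$ satisfies the corresponding non-dissipative system $$n_t + u n_x + b\, u_x n + \kappa\, \rho\rho_x = 0, \qquad \rho_t + (u\rho)_x = 0, \qquad n = A u,$$ for $x \in \mathbb{R}$, $0 < t < S$.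
   Context: Subscripts $t$ and $x$ denote partial derivatives. For a function $w(t,x)$ that is periodic in $x$ with period $1$ (i.e. a function on $S^1 = \mathbb{R}/\mathbb{Z}$ in the space variable), $\mu(w)(t) = \int_{S^1} w(t,x)\,dx$ denotes its spatial mean. The map $t \mapsto \frac{1-e^{-\lambda t}}{\lambda}$ is a bijection from $[0,T)$ onto $[0,S)$. The non-dissipative system is the weakly dissipative system with $\lambda$ set to $0$. *)

(* Defs.v *)
From Stdlib Require Import Reals.
From Coquelicot Require Import Coquelicot.

Open Scope R_scope.

(* A function w of (t,x) on [0,T) x R is a total function R -> R -> R, applied
   as [w t x], of which only the values at 0 <= t < T are ever constrained. *)

Definition Dt (w : R -> R -> R) (t x : R) : R := Derive (fun s => w s x) t.

Definition Dx (w : R -> R -> R) (t x : R) : R := Derive (fun y => w t y) x.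

Definition ex_Dt (w : R -> R -> R) (t x : R) : Prop :=
  ex_derive (fun s => w s x) t.

Definition ex_Dx (w : R -> R -> R) (t x : R) : Prop :=
  ex_derive (fun y => w t y) x.

Definition periodic (T : Rbar) (w : R -> R -> R) : Prop :=
  forall t x : R, 0 <= t -> Rbar_lt t T -> w t (x + 1) = w t x.

(* The integral over S^1 = R/Z, for w 1-periodic in x. *)
Definition mu (w : R -> R -> R) (t : R) : R := RInt (fun x => w t x) 0 1.

Inductive operator : Set :=
| Op_id_minus_dxx
| Op_minus_dxx
| Op_mu_minus_dxx.

Definition apply_op (A : operator) (w : R -> R -> R) (t x : R) : R :=
  match A with
  | Op_id_minus_dxx => w t x - Dx (Dx w) t x
  | Op_minus_dxx => - Dx (Dx w) t x
  | Op_mu_minus_dxx => mu w t - Dx (Dx w) t x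
  end.

(* [Derive] is total, so the existence of the derivatives has to be required
   separately.  Differentiability of w and r in x gives that of their product,
   and makes w(t,.) continuous, hence Riemann integrable on [0,1]. *)
Definition smooth (A : operator) (T : Rbar) (w r : R -> R -> R) : Prop :=
  forall t x : R, 0 < t -> Rbar_lt t T ->
    ex_Dx w t x /\ ex_Dx (Dx w) t x /\
    ex_Dt (apply_op A w) t x /\ ex_Dx (apply_op A w) t x /\
    ex_Dt r t x /\ ex_Dx r t x.

Definition dissipative_system (b kappa lambda : R) (A : operator) (T : Rbar)
    (v sigma : R -> R -> R) : Prop :=
  let m := apply_op A v in
  forall t x : R, 0 < t -> Rbar_lt t T ->
    Dt m t x + v t x * Dx m t x + b * Dx v t x * m t x + lambda * m t x
      + kappa * (sigma t x * Dx sigma t x) = 0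
    /\
    Dt sigma t x + Dx (fun t x => v t x * sigma t x) t x
      + lambda * sigma t x = 0.

Definition nondissipative_system (b kappa : R) (A : operator) (T : Rbar)
    (u rho : R -> R -> R) : Prop :=
  let n := apply_op A u in
  forall t x : R, 0 < t -> Rbar_lt t T ->
    Dt n t x + u t x * Dx n t x + b * Dx u t x * n t x
      + kappa * (rho t x * Dx rho t x) = 0
    /\
    Dt rho t x + Dx (fun t x => u t x * rho t x) t x = 0.

Definition rescaled_time (lambda t : R) : R := (1 - exp (- lambda * t)) / lambda.

(* The value at T = m_infty is irrelevant. *)
Definition rescaled_horizon (lambda : R) (T : Rbar) : R :=
  match T with
  | Finite T => rescaled_time lambda T
  | p_infty => 1 / lambda
  | m_infty => 0
  end.

(* Main.v *)
From Stdlib Require Import Reals Lra.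
From Coquelicot Require Import Coquelicot.
Require Import Defs.

Open Scope R_scope.

(** Write [s t = (1 - exp (- lambda t)) / lambda], so that
    [s' t = exp (- lambda t)], and let [S] be the limit of [s] at [T].
    Call [w] a damped copy of [W] when [w (t, x) = exp (- lambda t) W (s t, x)];
    the hypotheses say that [v] and [sigma] are damped copies of [u] and
    [rho].

    At a fixed time the factor is a constant, so being a damped copy passes to
    everything linear that acts in [x] only: [Dx] ([damped_Dx]), the mean, and
    hence each of the three operators [A] ([damped_apply_op]); thus [m = A v] is
    a damped copy of [n = A u].  In time, the product and chain rules give
    ([Dt_damped])
      [w_t = exp (- 2 lambda t) W_t - lambda w],
    since the factor [s'] produced by the chain rule equals the damping factor.
    The second summand is exactly what the terms [lambda m] and [lambda sigma]
    cancel, and all the other terms of the system are products of two damped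
    copies, hence carry [exp (- 2 lambda t)] as well.  So each left-hand side of
    the dissipative system at [(t, x)] is [exp (- 2 lambda t)] times the
    corresponding non-dissipative one at [(s t, x)].  As this factor does not
    vanish and [s] maps [(0, T)] onto [(0, S)], the two systems are
    equivalent. *)

(** * The change of time *)

Lemma rescaled_time_increasing (lambda t1 t2 : R) :
  0 < lambda -> t1 < t2 -> rescaled_time lambda t1 < rescaled_time lambda t2.
Proof.
intros Hl H12; unfold rescaled_time, Rdiv.
apply Rmult_lt_compat_r; [now apply Rinv_0_lt_compat|].
apply Rplus_lt_compat_l, Ropp_lt_contravar, exp_increasing; nra.
Qed.

Lemma rescaled_time_0 (lambda : R) : rescaled_time lambda 0 = 0.
Proof.
unfold rescaled_time; rewrite Rmult_0_r, exp_0; unfold Rdiv; ring.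
Qed.

Lemma rescaled_time_range (lambda : R) (T : Rbar) (t : R) :
  0 < lambda -> 0 < t -> Rbar_lt t T ->
  0 < rescaled_time lambda t /\
  Rbar_lt (rescaled_time lambda t) (rescaled_horizon lambda T).
Proof.
intros Hl Ht HtT; split.
- rewrite <- (rescaled_time_0 lambda); now apply rescaled_time_increasing.
- destruct T as [T| |]; simpl in *.
  + now apply rescaled_time_increasing.
  + unfold rescaled_time, Rdiv.
    apply Rmult_lt_compat_r; [now apply Rinv_0_lt_compat|].
    generalize (exp_pos (- lambda * t)); lra.
  + contradiction.
Qed.

(** The preimage is [t = - ln (1 - lambda s) / lambda]; the logarithm makes sense
    because the horizon never exceeds [1 / lambda]. *)
Lemma rescaled_time_surjective (lambda : R) (T : Rbar) (s : R) :
  0 < lambda -> 0 < s -> Rbar_lt s (rescaled_horizon lambda T) ->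
  exists t, 0 < t /\ Rbar_lt t T /\ rescaled_time lambda t = s.
Proof.
intros Hl Hs HsT.
assert (Hls : 0 < 1 - lambda * s).
{ assert (H : s < 1 / lambda).
  { destruct T as [T| |]; simpl in HsT.
    - apply Rlt_trans with (1 := HsT); unfold rescaled_time, Rdiv.
      apply Rmult_lt_compat_r; [now apply Rinv_0_lt_compat|].
      generalize (exp_pos (- lambda * T)); lra.
    - exact HsT.
    - lra. }
  apply (Rmult_lt_compat_l lambda) in H; [|exact Hl].
  replace (lambda * (1 / lambda)) with 1 in H by (field; lra); lra. }
set (t := - ln (1 - lambda * s) / lambda).
assert (Ets : rescaled_time lambda t = s).
{ unfold rescaled_time.
  replace (- lambda * t) with (ln (1 - lambda * s)) by (unfold t; field; lra).
  rewrite exp_ln by exact Hls; field; lra. }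
(* Both bounds on [t] follow from those on [s] because [rescaled_time] reflects
   the order. *)
assert (reflects : forall a c,
  rescaled_time lambda a < rescaled_time lambda c -> a < c).
{ intros a c H; destruct (Rlt_or_le a c) as [|[Hca|Hca]]; [assumption| |].
  - apply (rescaled_time_increasing lambda) in Hca; lra.
  - subst c; lra. }
exists t; split; [|split; [|exact Ets]].
- apply reflects; rewrite rescaled_time_0, Ets; exact Hs.
- destruct T as [T| |]; simpl in *.
  + apply reflects; now rewrite Ets.
  + exact I.
  + lra.
Qed.

Lemma is_derive_rescaled_time (lambda t : R) :
  0 < lambda -> is_derive (rescaled_time lambda) t (exp (- lambda * t)).
Proof.
intros Hl; unfold rescaled_time; auto_derive; [exact I|field; lra].
Qed.

Lemma locally_before_horizon (T : Rbar) (t : R) :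
  0 < t -> Rbar_lt t T -> locally t (fun t' => 0 < t' /\ Rbar_lt t' T).
Proof.
intros Ht HtT.
apply filter_and; [exact (open_gt 0 t Ht)|].
now apply (open_Rbar_lt' t T).
Qed.

(** * Damped copies *)

(** Only positive times are constrained, since [Dt] needs the relation on a
    neighbourhood and the two systems are posed at positive times. *)
Definition damped_copy (lambda : R) (T : Rbar) (w W : R -> R -> R) : Prop :=
  forall t x : R, 0 < t -> Rbar_lt t T ->
    w t x = exp (- lambda * t) * W (rescaled_time lambda t) x.

Lemma damped_Dx (lambda : R) (T : Rbar) (w W : R -> R -> R) :
  damped_copy lambda T w W -> damped_copy lambda T (Dx w) (Dx W).
Proof.
intros H t x Ht HtT; unfold Dx.
rewrite <- Derive_scal; apply Derive_ext; intros y; now apply H.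
Qed.

Lemma Dx_mult_damped (lambda : R) (T : Rbar) (w W r P : R -> R -> R) (t x : R) :
  damped_copy lambda T w W -> damped_copy lambda T r P -> 0 < t -> Rbar_lt t T ->
  Dx (fun t x => w t x * r t x) t x =
  (exp (- lambda * t)) ^ 2 *
  Dx (fun t x => W t x * P t x) (rescaled_time lambda t) x.
Proof.
intros Hw Hr Ht HtT; unfold Dx.
rewrite <- Derive_scal; apply Derive_ext; intros y.
rewrite (Hw t y Ht HtT), (Hr t y Ht HtT); ring.
Qed.

(** The mean is linear only on integrable functions; differentiability of [W] in
    [x] supplies this through continuity. *)
Lemma mu_damped (lambda : R) (T : Rbar) (w W : R -> R -> R) (t : R) :
  damped_copy lambda T w W -> 0 < t -> Rbar_lt t T ->
  (forall x, ex_Dx W (rescaled_time lambda t) x) ->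
  mu w t = exp (- lambda * t) * mu W (rescaled_time lambda t).
Proof.
intros H Ht HtT HW; unfold mu.
rewrite (RInt_ext _
  (fun x => scal (exp (- lambda * t)) (W (rescaled_time lambda t) x)))
  by (intros x _; now apply H).
apply (RInt_scal (fun x => W (rescaled_time lambda t) x)).
apply (ex_RInt_continuous (fun x => W (rescaled_time lambda t) x)).
intros x _.
apply (ex_derive_continuous (fun x => W (rescaled_time lambda t) x)), HW.
Qed.

Lemma damped_apply_op (lambda : R) (A : operator) (T : Rbar)
    (w W : R -> R -> R) :
  damped_copy lambda T w W ->
  (forall t x, 0 < t -> Rbar_lt t T -> ex_Dx W (rescaled_time lambda t) x) ->
  damped_copy lambda T (apply_op A w) (apply_op A W).
Proof.
intros H HW t x Ht HtT.
assert (Hxx := damped_Dx _ _ _ _ (damped_Dx _ _ _ _ H) t x Ht HtT).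
destruct A; simpl; rewrite Hxx.
- rewrite (H t x Ht HtT); ring.
- ring.
- rewrite (mu_damped lambda T w W t H Ht HtT) by (intros y; now apply HW).
  ring.
Qed.

(** The rescaling of time is chosen so that its derivative is the damping factor
    itself: this is why a quadratic factor appears in front of [Dt W]. *)
Lemma Dt_damped (lambda : R) (T : Rbar) (w W : R -> R -> R) (t x : R) :
  0 < lambda -> damped_copy lambda T w W -> 0 < t -> Rbar_lt t T ->
  ex_Dt W (rescaled_time lambda t) x ->
  Dt w t x =
  (exp (- lambda * t)) ^ 2 * Dt W (rescaled_time lambda t) x - lambda * w t x.
Proof.
intros Hl H Ht HtT HW.
rewrite (H t x Ht HtT).
set (e := exp (- lambda * t)); set (s := rescaled_time lambda t).
assert (He : is_derive (fun t => exp (- lambda * t)) t (- lambda * e)).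
{ unfold e; auto_derive; [exact I|ring]. }
assert (Hc := is_derive_comp (fun s => W s x) (rescaled_time lambda) t _ _
  (Derive_correct _ _ HW) (is_derive_rescaled_time lambda t Hl)).
assert (Hp := is_derive_mult _ _ t _ _ He Hc Rmult_comm).
unfold Dt.
rewrite (Derive_ext_loc (fun t => w t x)
  (fun t => exp (- lambda * t) * W (rescaled_time lambda t) x)).
- apply is_derive_unique in Hp; etransitivity; [exact Hp|].
  unfold plus, mult, scal; simpl; unfold mult; simpl; fold e s; ring.
- apply (filter_imp _ _ (fun t' Ht' => H t' x (proj1 Ht') (proj2 Ht'))).
  now apply locally_before_horizon.
Qed.

(** * The equivalence of the two systems *)

Theorem theorem2p1 (b kappa lambda : R) (A : operator) (T : Rbar)
    (u rho v sigma : R -> R -> R)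
    (hkappa : kappa = 1 \/ kappa = -1)
    (hlambda : 0 < lambda)
    (hT : Rbar_lt 0 T)
    (hper : A = Op_mu_minus_dxx ->
      periodic (rescaled_horizon lambda T) u /\
      periodic (rescaled_horizon lambda T) rho /\
      periodic T v /\ periodic T sigma)
    (hu : smooth A (rescaled_horizon lambda T) u rho)
    (hv : smooth A T v sigma)
    (hrel_v : forall t x : R, 0 <= t -> Rbar_lt t T ->
      v t x = exp (- lambda * t) * u (rescaled_time lambda t) x)
    (hrel_sigma : forall t x : R, 0 <= t -> Rbar_lt t T ->
      sigma t x = exp (- lambda * t) * rho (rescaled_time lambda t) x) :
  dissipative_system b kappa lambda A T v sigma <->
  nondissipative_system b kappa A (rescaled_horizon lambda T) u rho.
Proof.
assert (Dv : damped_copy lambda T v u).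
{ intros t x Ht HtT; apply hrel_v; [now left|exact HtT]. }
assert (Ds : damped_copy lambda T sigma rho).
{ intros t x Ht HtT; apply hrel_sigma; [now left|exact HtT]. }
assert (Su : forall t x, 0 < t -> Rbar_lt t T ->
  ex_Dx u (rescaled_time lambda t) x /\
  ex_Dt (apply_op A u) (rescaled_time lambda t) x /\
  ex_Dt rho (rescaled_time lambda t) x).
{ intros t x Ht HtT.
  destruct (rescaled_time_range lambda T t hlambda Ht HtT) as [H0 HS].
  destruct (hu _ x H0 HS) as (? & ? & ? & ? & ? & ?); tauto. }
assert (Dm : damped_copy lambda T (apply_op A v) (apply_op A u)).
{ apply damped_apply_op; [exact Dv|intros t x Ht HtT; exact (proj1 (Su t x Ht HtT))]. }
assert (momentum : forall t x s, 0 < t -> Rbar_lt t T ->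
  s = rescaled_time lambda t ->
  Dt (apply_op A v) t x + v t x * Dx (apply_op A v) t x
    + b * Dx v t x * apply_op A v t x + lambda * apply_op A v t x
    + kappa * (sigma t x * Dx sigma t x) =
  (exp (- lambda * t)) ^ 2 *
  (Dt (apply_op A u) s x + u s x * Dx (apply_op A u) s x
    + b * Dx u s x * apply_op A u s x + kappa * (rho s x * Dx rho s x))).
{ intros t x s Ht HtT ->.
  rewrite (Dt_damped lambda T _ _ t x hlambda Dm Ht HtT)
    by exact (proj1 (proj2 (Su t x Ht HtT))).
  rewrite (damped_Dx _ _ _ _ Dm t x Ht HtT), (damped_Dx _ _ _ _ Dv t x Ht HtT),
    (damped_Dx _ _ _ _ Ds t x Ht HtT), (Dm t x Ht HtT), (Dv t x Ht HtT),
    (Ds t x Ht HtT).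
  ring. }
assert (transport : forall t x s, 0 < t -> Rbar_lt t T ->
  s = rescaled_time lambda t ->
  Dt sigma t x + Dx (fun t x => v t x * sigma t x) t x + lambda * sigma t x =
  (exp (- lambda * t)) ^ 2 *
  (Dt rho s x + Dx (fun t x => u t x * rho t x) s x)).
{ intros t x s Ht HtT ->.
  rewrite (Dt_damped lambda T _ _ t x hlambda Ds Ht HtT)
    by exact (proj2 (proj2 (Su t x Ht HtT))).
  rewrite (Dx_mult_damped _ _ _ _ _ _ t x Dv Ds Ht HtT).
  ring. }
assert (factor : forall t, (exp (- lambda * t)) ^ 2 <> 0).
{ intros t; apply pow_nonzero, Rgt_not_eq, exp_pos. }
unfold dissipative_system, nondissipative_system; split.
- intros Hd s x Hs HsS.
  destruct (rescaled_time_surjective lambda T s hlambda Hs HsS)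
    as (t & Ht & HtT & <-).
  destruct (Hd t x Ht HtT) as [H1 H2].
  rewrite (momentum t x _ Ht HtT eq_refl) in H1.
  rewrite (transport t x _ Ht HtT eq_refl) in H2.
  split; apply (Rmult_eq_reg_l ((exp (- lambda * t)) ^ 2)); try apply factor;
    rewrite Rmult_0_r; assumption.
- intros Hn t x Ht HtT.
  destruct (rescaled_time_range lambda T t hlambda Ht HtT) as [H0 HS].
  destruct (Hn _ x H0 HS) as [H1 H2].
  rewrite (momentum t x _ Ht HtT eq_refl), (transport t x _ Ht HtT eq_refl).
  rewrite H1, H2; split; ring.
Qed.
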